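(* Let $S_n(x;\lambda,z)$ be the monic polynomials orthogonal with respect to the $\Delta$-Sobolev inner product $\langle p,q\rangle=L[pq]+\lambda L[\Delta p\,\Delta q]$, where $b>-1$, $z>0$, $\lambda\ge 0$; let $\varphi_n$ be the falling factorial polynomials, and let $\omega_k=\omega_k(x;z)$ and $\alpha_k=\alpha_k(\lambda,z)$ be the coefficients specified in the context. Suppose that $$\frac{S_n(x;\lambda,z)}{\varphi_n(x)}\sim\sum_{k\ge 0}\sigma_k(x;z)\,n^{-k},\qquad n\to\infty .$$ Then $$\sigma_0=1,\qquad \sigma_1=z,\qquad \sigma_2=\omega_2+z,$$ $$\sigma_3=\omega_3+\left[x+1+z+\alpha_2\right]z,$$ $$\sigma_4=\omega_4+\left[(x+1)^2+(z+\alpha_2)(x+1)+z(2+\alpha_2)+\omega_2+\alpha_3\right]z .$$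
   Context: $\mathbb{R}[x]$ denotes the real polynomials. The Pochhammer symbol is $(c)_0=1$, $(c)_n=\prod_{j=0}^{n-1}(c+j)$ for $n\ge1$. For $b>-1$ and $z>0$, the linear functional $L:\mathbb{R}[x]\to\mathbb{R}$ is $$L[p]=\sum_{x=0}^{\infty}\frac{p(x)}{(b+1)_x}\frac{z^x}{x!}.$$ The forward difference operator is $\Delta[p](x)=p(x+1)-p(x)$. The monic polynomials $S_n(x;\lambda,z)$ have degree $n$. The falling factorial polynomials are $\varphi_0(x)=1$, $\varphi_n(x)=\prod_{k=0}^{n-1}(x-k)$ for $n\ge1$. The symbol $\sim$ denotes an asymptotic expansion as $n\to\infty$. The generalized Charlier polynomials $P_n(x;z)$ are the monic polynomials with $\deg P_n=n$, orthogonal with respect to $L$. The $\omega_k(x;z)$ are the coefficients of the known asymptotic expansion $$\frac{P_n(x;z)}{\varphi_n(x)}\sim\sum_{k\ge0}\omega_k(x;z)\,n^{-k},\qquad n\to\infty ,$$ the first of which are $$\omega_0=1,\quad \omega_1=z,\quad \omega_2=(x+1-b)z+\frac{z^2}{2},$$ $$\omega_3=\left[(x+1)(x+1-b)+b^2\right]z+\left[2(x+1-b)+1\right]\frac{z^2}{2}+\frac{z^3}{6}.$$ Let $h_n=L[P_n^2]$, $\widetilde h_n=\langle S_n,S_n\rangle$, and $a_n(\lambda,z)=\dfrac{(n-1)\lambda}{z}\dfrac{h_n}{\widetilde h_{n-1}}$ for $n\ge1$. The $\alpha_k(\lambda,z)$ are the coefficients of the asymptotic expansion $a_n(\lambda,z)\sim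 z\sum_{k\ge1}\alpha_k(\lambda,z)n^{-k}$ as $n\to\infty$, the first of which are $$\alpha_1=1,\quad \alpha_2=1-2b,\quad \alpha_3=1+3b(b-1)-\frac{z}{\lambda}.$$ *)

(* Defs.v *)
From HB Require Import structures.
From mathcomp Require Export all_boot all_order all_algebra.
From mathcomp Require Export all_classical all_reals all_analysis.
Export Order.TTheory GRing.Theory Num.Theory.
Export numFieldNormedType.Exports.

Set Implicit Arguments.
Unset Strict Implicit.
Unset Printing Implicit Defensive.

Local Open Scope classical_set_scope.
Local Open Scope ring_scope.

Definition pochhammer (R : realType) (c : R) (n : nat) : R :=
  \prod_(j < n) (c + j%:R).

Definition falling_poly (R : realType) (n : nat) : {poly R} :=
  \prod_(k < n) ('X - (k%:R)%:P).

Definition fwd_diff (R : realType) (p : {poly R}) : {poly R} :=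
  p \Po ('X + 1) - p.

Definition charlier_weight (R : realType) (b z : R) (k : nat) : R :=
  (pochhammer (b + 1) k)^-1 * (z ^+ k / k`!%:R).

(* [limn] is a total operator; for b > -1 the terms have no zero denominator
   and the series converges absolutely. *)
Definition charlier_L (R : realType) (b z : R) (p : {poly R}) : R :=
  limn (series (fun k : nat => p.[k%:R] * charlier_weight b z k)).

Definition charlier_prod (R : realType) (b z : R) (p q : {poly R}) : R :=
  charlier_L b z (p * q).

Definition sobolev_prod (R : realType) (b z lambda : R) (p q : {poly R}) : R :=
  charlier_L b z (p * q)
  + lambda * charlier_L b z (fwd_diff p * fwd_diff q).

(* The norms B (P n) (P n) are not required to be nonzero: both products used
   here are positive definite when b > -1, z > 0 and lambda >= 0. *)
Definition monic_orthogonal (R : realType)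
    (B : {poly R} -> {poly R} -> R) (P : nat -> {poly R}) : Prop :=
  (forall n, P n \is monic /\ size (P n) = n.+1) /\
  (forall m n, m <> n -> B (P m) (P n) = 0).

(* Meaningful for n >= 1; [n.-1] truncates, so the value at n = 0 is junk. *)
Definition sobolev_a (R : realType) (b z lambda : R) (P S : nat -> {poly R})
    (n : nat) : R :=
  n.-1%:R * lambda / z
  * (charlier_L b z (P n ^+ 2) / sobolev_prod b z lambda (S n.-1) (S n.-1)).

(* Poincare asymptotic expansion  f(n) ~ sum_(k >= m) c_k n^(-k),  n -> oo,
   m being the first index of the formal series; the n = 0 terms, where the
   divisions are junk, do not affect the little-o at infinity. *)
Definition asymp_expansion (R : realType) (m : nat) (f c : nat -> R) : Prop :=
  forall N : nat,
    (fun n : nat => f n - \sum_(m <= k < N.+1) c k / n%:R ^+ k)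
      =o_\oo (fun n : nat => (n%:R ^+ N)^-1 : R).

(* Main.v *)
From mathcomp Require Import lra ring.
Require Import Defs.

(* Pearson's equation (k + 1) (k + 1 + b) w(k + 1) = z w(k) for the weight of L
   gives Delta P_n = n P_(n-1) + c_n P_(n-2), so P_n is orthogonal to S_k for
   k < n - 1 in the Sobolev product as well, and P_n = S_n + a_n S_(n-1).
   Dividing by the falling factorials, s_n = S_n(x) / phi_n(x) and
   p_n = P_n(x) / phi_n(x) satisfy (n - 1 - x) (s_n - p_n) = a_n s_(n-1), and
   the coefficients are compared after expanding both sides in powers of 1/n. *)

Set Implicit Arguments.
Unset Strict Implicit.
Unset Printing Implicit Defensive.

Local Open Scope classical_set_scope.
Local Open Scope ring_scope.

(** * The functional [L]: convergence, Pearson's equation, positivity *)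

(** A geometric bound is weaker than polynomial growth, but it is the form that lets an exponential
    series dominate [L]. In the Horner induction [k <= 2 ^ k] absorbs each factor ['X]. *)
Lemma poly_exp_bound (R : realType) (p : {poly R}) :
  exists C M : R, [/\ 0 <= C, 1 <= M &
    forall k : nat, `|p.[k%:R]| <= C * M ^+ k].
Proof.
elim/poly_ind: p => [|p c [C [M [C0 M1 H]]]].
  by exists 0, 1; split=> // k; rewrite horner0 normr0 mul0r.
exists (C + `|c|), (2 * M); split; [exact: addr_ge0|lra|] => k.
have M0 : 0 <= M by lra.
rewrite hornerMXaddC (le_trans (ler_normD _ _)) // mulrDl lerD //.
  rewrite normrM normr_nat exprMn [2 ^+ k * _]mulrC mulrA ler_pM //.
  by rewrite -natrX ler_nat ltnW // ltn_expl.
by rewrite ler_peMr // exprn_ege1 //; lra.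
Qed.

Section CharlierFunctional.
Context {R : realType} (b z : R).
Hypotheses (hb : -1 < b) (hz : 0 < z).

Local Notation w := (charlier_weight b z).
Local Notation L := (charlier_L b z).
Implicit Types p q : {poly R}.

Lemma pochhammer_gt0 k : 0 < pochhammer (b + 1) k.
Proof.
by apply: prodr_gt0 => j _; rewrite ltr_wpDr // -ltrBlDr sub0r.
Qed.

Lemma charlier_weight_gt0 k : 0 < w k.
Proof.
rewrite mulr_gt0 ?invr_gt0 ?pochhammer_gt0 //.
by rewrite divr_gt0 ?exprn_gt0 // ltr0n fact_gt0.
Qed.

Lemma charlier_weightS k :
  k.+1%:R * (k.+1%:R + b) * w k.+1 = z * w k.
Proof.
rewrite /charlier_weight /pochhammer big_ord_recr /= factS natrM exprS.
have := pochhammer_gt0 k; rewrite /pochhammer.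
move: (\prod_(j < k) _) => P P0.
have k0 : k`!%:R != 0 :> R by rewrite pnatr_eq0 -lt0n fact_gt0.
have kb : 0 < b + 1 + k%:R.
  by rewrite ltr_wpDr // -ltrBlDr sub0r.
rewrite -[k.+1%:R]natr1; field.
by rewrite k0 natr1 pnatr_eq0 /= (gt_eqF kb) (gt_eqF P0).
Qed.

(** For [k >= 1] the first Pochhammer factor is [b + 1], possibly below 1, and all later ones are at
    least 1. The summand 1 covers [k = 0]. *)
Lemma charlier_weight_le k : w k <= (1 + (b + 1)^-1) * (z ^+ k / k`!%:R).
Proof.
have b1 : 0 < b + 1 by rewrite -ltrBlDr sub0r.
apply: ler_wpM2r; first by rewrite divr_ge0 ?exprn_ge0 // ltW.
case: k => [|k]; first by rewrite /pochhammer big_ord0 invr1 lerDl invr_ge0 ltW.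
rewrite ler_wpDl // lef_pV2 ?posrE ?pochhammer_gt0 //.
rewrite /pochhammer big_ord_recl addr0 ler_peMr ?(ltW b1) //.
apply: (big_ind (fun t => 1 <= t)) => // [t u t1 u1|j _].
  exact: mulr_ege1.
by rewrite ler_wpDl ?(ltW b1) // ler1n.
Qed.

Lemma is_cvg_charlier_series p :
  cvgn (series (fun k : nat => p.[k%:R] * w k)).
Proof.
have [C [M [C0 M1 H]]] := poly_exp_bound p.
have b1 : 0 < b + 1 by rewrite -ltrBlDr sub0r.
have M0 : 0 <= M by lra.
have cb : 0 <= 1 + (b + 1)^-1 by rewrite addr_ge0 // invr_ge0 ltW.
apply: normed_cvg.
(* The two bounds combine into a multiple of the exponential series at [M * z]. *)
apply: (@series_le_cvg _ _ ((C * (1 + (b + 1)^-1)) *: exp_coeff (M * z))) => //.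
- by move=> k; exact: normr_ge0.
- move=> k; rewrite -[leRHS]/(_ * exp_coeff _ _); apply: mulr_ge0.
    exact: mulr_ge0.
  by apply: exp_coeff_ge0; rewrite mulr_ge0 // ltW.
- move=> k /=; rewrite normrM (gtr0_norm (charlier_weight_gt0 k)).
  apply: (le_trans (ler_pM _ _ (H k) (charlier_weight_le k))) => //.
    exact/ltW/charlier_weight_gt0.
  rewrite le_eqVlt; apply/orP; left; apply/eqP.
  rewrite -[RHS]/(C * (1 + (b + 1)^-1) * exp_coeff (M * z) k).
  rewrite /exp_coeff /= exprMn.
  ring.
- exact/is_cvg_seriesZ/is_cvg_series_exp_coeff.
Qed.

Lemma charlier_LD p q : L (p + q) = L p + L q.
Proof.
rewrite /charlier_L -lim_seriesD; [|exact: is_cvg_charlier_series..].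
congr (limn (series _)); apply/funext => k.
by rewrite hornerD mulrDl.
Qed.

Lemma charlier_LZ c p : L (c *: p) = c * L p.
Proof.
rewrite /charlier_L -[RHS]/(c *: (_ : R^o)).
rewrite -lim_seriesZ; last exact: is_cvg_charlier_series.
congr (limn (series _)); apply/funext => k.
by rewrite hornerZ -mulrA.
Qed.

Lemma charlier_LB p q : L (p - q) = L p - L q.
Proof. by rewrite charlier_LD -scaleN1r charlier_LZ mulN1r. Qed.

(** Pearson's equation summed against [p (k + 1)]. Shifting the index loses no term, since the
    factor ['X] kills the one at [k = 0]. *)
Lemma charlier_L_shift p : z * L (p \Po ('X + 1)) = L ('X * ('X + b%:P) * p).
Proof.
rewrite /charlier_L -[z * _]/(z *: (_ : R^o)).
rewrite -lim_seriesZ; last exact: is_cvg_charlier_series.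
set v := (fun k : nat => ('X * ('X + b%:P) * p).[k%:R] * w k).
have cv : cvgn (series v) by exact: is_cvg_charlier_series.
have -> : z *: (fun k : nat => (p \Po ('X + 1)).[k%:R] * w k) =
  (fun k => v k.+1).
  apply/funext => k; rewrite /v -[LHS]/(z * _) horner_comp.
  rewrite !(hornerM, hornerD, hornerX, hornerC).
  by rewrite natr1 mulrCA -charlier_weightS; ring.
apply/cvg_lim => //.
have -> : series (fun k => v k.+1) = (fun n => series v n.+1).
  have v0 : v 0%N = 0 by rewrite /v -mulrA hornerM hornerX !mul0r.
  apply/funext => n; rewrite /series /= [RHS]big_nat_recl //=.
  by rewrite v0 add0r.
by rewrite (@cvg_shiftS _ (series v)).
Qed.

Lemma charlier_L_sqr_ge0 p : 0 <= L (p ^+ 2).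
Proof.
apply: limr_ge; first exact: is_cvg_charlier_series.
near=> n; apply: sumr_ge0 => k _.
by rewrite mulr_ge0 ?(ltW (charlier_weight_gt0 _)) // horner_exp sqr_ge0.
Unshelve. all: by end_near.
Qed.

Lemma charlier_L_sqr_gt0 p : p != 0 -> 0 < L (p ^+ 2).
Proof.
move=> p0.
(* Otherwise the first [size p] naturals would be too many distinct roots. *)
have [k pk] : exists k : nat, p.[k%:R] != 0.
  apply: contrapT => np.
  have rk (k : nat) : root p k%:R.
    by rewrite rootE; apply: contrapT => /negP ?; apply: np; exists k.
  suff : (size [seq (i%:R : R) | i <- iota 0 (size p)] < size p)%N.
    by rewrite size_map size_iota ltnn.
  apply: (@max_poly_roots R) => //.
    by apply/allP => _ /mapP[i _ ->].
  by rewrite map_inj_uniq ?iota_uniq // => i j /eqP; rewrite eqr_nat => /eqP.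
have wk := charlier_weight_gt0.
apply: (@lt_le_trans _ _ (series (fun k : nat => (p ^+ 2).[k%:R] * w k) k.+1)).
  rewrite seriesSr ltr_wpDl //.
    apply: sumr_ge0 => i _.
    by rewrite mulr_ge0 ?(ltW (wk _)) // horner_exp sqr_ge0.
  by rewrite horner_exp mulr_gt0 // exprn_even_gt0.
apply: nondecreasing_cvgn_le; last exact: is_cvg_charlier_series.
apply/nondecreasing_seqP => n; rewrite seriesSr lerDl.
by rewrite mulr_ge0 ?(ltW (wk _)) // horner_exp sqr_ge0.
Qed.

End CharlierFunctional.

(** * Leading coefficients and linear forms on polynomials *)

(** The discrete analogue of differentiating the top term of a polynomial of degree at most
    [i + 1]. *)
Lemma coef_bwd_diff (R : comNzRingType) (p : {poly R}) (i : nat) :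
  (size p <= i.+2)%N -> (p - (p \Po ('X - 1)))`_i = i.+1%:R * p`_i.+1.
Proof.
elim/poly_ind: p i => [|p c IH] i.
  by rewrite comp_poly0 subr0 !coef0 mulr0.
rewrite size_MXaddC => hs.
have {}hs : (size p <= i.+1)%N.
  by move: hs; case: eqP => [-> _|_] /=; rewrite ?size_poly0.
rewrite comp_poly_MXaddC.
(* Leibniz rule for the backward difference of [p * 'X]. *)
have -> : p * 'X + c%:P - ((p \Po ('X - 1)) * ('X - 1) + c%:P) =
  p + (p - (p \Po ('X - 1))) * 'X - (p - (p \Po ('X - 1))) by ring.
rewrite coefB [in LHS]coefD [in RHS]coefD coefC !coefMX /= addr0.
rewrite (IH i) ?(leq_trans hs) //.
rewrite [p`_i.+1]nth_default // mulr0 subr0.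
case: i hs => [|i] hs /=; first by rewrite addr0 mul1r.
by rewrite IH // -[i.+2%:R]nat1r mulrDl mul1r.
Qed.

Lemma size_sub_lead (R : nzRingType) (p q : {poly R}) n :
  p \is monic -> size p = n.+1 -> (size q <= n.+1)%N ->
  (size (q - q`_n *: p)%R <= n)%N.
Proof.
move=> /monicP pm sp sq; apply/leq_sizeP => j.
rewrite coefB coefZ leq_eqVlt => /predU1P[<-|nj].
  by move: pm; rewrite /lead_coef sp => ->; rewrite mulr1 subrr.
rewrite [q`_j]nth_default ?(leq_trans sq) //.
by rewrite [p`_j]nth_default ?sp // mulr0 subrr.
Qed.

(** Monic polynomials of degrees 0 to [n - 1] span all polynomials of size at most [n]. An abstract
    [f] serves both the Charlier and the Sobolev product. *)
Lemma linear_form_eq0 (R : nzRingType) (f : {poly R} -> R)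
    (S : nat -> {poly R}) (n : nat) (r : {poly R}) :
  (forall p q, f (p + q) = f p + f q) -> (forall c p, f (c *: p) = c * f p) ->
  (forall k, S k \is monic /\ size (S k) = k.+1) ->
  (forall k, (k < n)%N -> f (S k) = 0) -> (size r <= n)%N -> f r = 0.
Proof.
move=> fD fZ HS; elim: n r => [|n IH] r fS sr.
  move: sr; rewrite leqn0 size_poly_eq0 => /eqP ->.
  by rewrite -(scale0r 0) fZ mul0r.
have [Sm Ss] := HS n.
rewrite -(subrK (r`_n *: S n) r) fD fZ fS // mulr0 addr0.
apply: IH; last exact: size_sub_lead.
by move=> k kn; apply: fS; exact: ltnW.
Qed.

Lemma monic_coef (R : nzRingType) (p : {poly R}) n :
  p \is monic -> size p = n.+1 -> p`_n = 1.
Proof. by rewrite monicE /lead_coef => /eqP + sp; rewrite sp. Qed.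

(** * The connection formula between [P] and [S] *)

Section Connection.
Context {R : realType} (b z lambda : R).
Hypotheses (hb : -1 < b) (hz : 0 < z) (hlambda : 0 <= lambda).
Context {P S : nat -> {poly R}}.
Hypotheses (hP : monic_orthogonal (charlier_prod b z) P)
           (hS : monic_orthogonal (sobolev_prod b z lambda) S).

Local Notation L := (charlier_L b z).
Local Notation "<[ p , q ]>" := (sobolev_prod b z lambda p q)
  (at level 0, format "<[ p ,  q ]>").
Implicit Types p q r : {poly R}.

Lemma charlier_orthogonal n r : (size r <= n)%N -> L (P n * r) = 0.
Proof.
case: hP => Pm Po; apply: (@linear_form_eq0 R (fun r => L (P n * r)) P) => //.
- by move=> p q; rewrite mulrDr charlier_LD.
- by move=> c p; rewrite -scalerAr charlier_LZ.
- by move=> k kn; apply: Po; apply/eqP; rewrite gtn_eqF.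
Qed.

Lemma charlier_lead n r :
  (size r <= n.+1)%N -> L (P n * r) = r`_n * L (P n ^+ 2).
Proof.
have [Pm Ps] := hP.1 n => sr.
rewrite -[in LHS](subrK (r`_n *: P n) r) mulrDr charlier_LD //.
rewrite charlier_orthogonal ?add0r; last exact: size_sub_lead.
by rewrite -scalerAr charlier_LZ.
Qed.

Lemma fwd_diffD p q : fwd_diff (p + q) = fwd_diff p + fwd_diff q.
Proof. by rewrite /fwd_diff comp_polyD; ring. Qed.

Lemma fwd_diffZ c p : fwd_diff (c *: p) = c *: fwd_diff p.
Proof. by rewrite /fwd_diff comp_polyZ scalerBr. Qed.

Lemma size_fwd_diff p : (size (fwd_diff p) <= size p)%N.
Proof.
apply: (leq_trans (size_polyD _ _)); rewrite size_polyN geq_max leqnn andbT.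
by rewrite -[1]/(1%:P) size_comp_poly2 // size_XaddC.
Qed.

(** Puts [fwd_diff q] under the same shift as [P n.+1], so that [charlier_L_shift] applies to their
    product. *)
Lemma fwd_diff_comp p : fwd_diff p = (p - (p \Po ('X - 1))) \Po ('X + 1).
Proof.
by rewrite comp_polyB -comp_polyA comp_polyB comp_polyX rmorph1
  addrK comp_polyXr.
Qed.

Lemma sobolev_prodDr p q r : <[p, q + r]> = <[p, q]> + <[p, r]>.
Proof.
by rewrite /sobolev_prod fwd_diffD !mulrDr !charlier_LD //; ring.
Qed.

Lemma sobolev_prodZr p c q : <[p, c *: q]> = c * <[p, q]>.
Proof.
by rewrite /sobolev_prod fwd_diffZ -!scalerAr !charlier_LZ //; ring.
Qed.

Lemma sobolev_prodC p q : <[p, q]> = <[q, p]>.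
Proof. by rewrite /sobolev_prod mulrC [fwd_diff p * _]mulrC. Qed.

Lemma sobolev_prod_gt0 p : p != 0 -> 0 < <[p, p]>.
Proof.
move=> p0; rewrite /sobolev_prod -!expr2 ltr_wpDr ?charlier_L_sqr_gt0 //.
by rewrite mulr_ge0 // charlier_L_sqr_ge0.
Qed.

(* Pearson's equation turns the difference operator acting on [P n.+1] into
   multiplication by [X (X + b)] acting on the other factor. *)
Lemma sobolev_charlier n q : (size q <= n.+1)%N ->
  <[P n.+1, q]> = n%:R * lambda / z * L (P n.+1 ^+ 2) * q`_n.
Proof.
move=> sq; rewrite /sobolev_prod charlier_orthogonal // add0r.
(* Of the difference of [P n.+1] only the shifted half survives; the other is orthogonal to
   [fwd_diff q]. *)
rewrite {1}/fwd_diff mulrBl charlier_LB //.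
rewrite [X in _ - X]charlier_orthogonal ?(leq_trans (size_fwd_diff q)) // subr0.
rewrite fwd_diff_comp -comp_polyM.
set D := q - _.
have Dsz : (size D <= n)%N.
  apply/leq_sizeP => j nj; rewrite coef_bwd_diff; last first.
    by rewrite (leq_trans sq) // ltnS leqW.
  by rewrite nth_default ?mulr0 // (leq_trans sq).
rewrite -[L (_ \Po _)](mulKf (lt0r_neq0 hz)) charlier_L_shift //.
have -> : 'X * ('X + b%:P) * (P n.+1 * D) =
  P n.+1 * ((D * 'X + b *: D) * 'X) by rewrite -mul_polyC; ring.
(* The cofactor of [P n.+1] has degree at most [n + 1], so only its top coefficient counts. For
   [n > 0] this is the coefficient of [D] at [n - 1], namely [n] times that of [q] at [n]. *)
rewrite charlier_lead; last first.
  rewrite (leq_trans (size_polyMleq _ _)) // size_polyX addn2 /= ltnS.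
  rewrite (leq_trans (size_polyD _ _)) // geq_max.
  rewrite (leq_trans (size_polyMleq _ _)) ?size_polyX ?addn2 //=.
  by rewrite (leq_trans (size_scale_leq _ _)) // (leq_trans Dsz).
rewrite coefMX /= coefD coefZ [D`_n]nth_default // mulr0 addr0 coefMX.
case: n sq Dsz => [|n] sq Dsz /=; first by rewrite !mul0r !mulr0.
by rewrite coef_bwd_diff //; field; rewrite gt_eqF.
Qed.

(** The difference [T] of the two sides has degree at most [n], as the leading terms cancel, and is
    Sobolev-orthogonal to [S 0], ..., [S n]. Hence it is orthogonal to itself and vanishes by
    positive definiteness. *)
Lemma charlier_sobolev_connection n :
  P n.+1 = S n.+1 + sobolev_a b z lambda P S n.+1 *: S n.
Proof.
set a := sobolev_a _ _ _ _ _ _.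
have [Pm Ps] := hP.1 n.+1; have [Sm Ss] := hS.1 n.+1.
have [Sm' Ss'] := hS.1 n; have So := hS.2.
have Sn0 : S n != 0 by rewrite -size_poly_eq0 Ss'.
pose T := P n.+1 + (-1 *: S n.+1 + - a *: S n).
suff T0 : T == 0.
  by move: T0; rewrite /T scaleN1r scaleNr -opprD subr_eq0 => /eqP.
have sT : (size T <= n.+1)%N.
  apply/leq_sizeP => j; rewrite !coefD !coefZ.
  rewrite leq_eqVlt => /predU1P[<-|nj].
    rewrite !(monic_coef Pm Ps) !(monic_coef Sm Ss) nth_default ?Ss' //; ring.
  by rewrite !nth_default ?Ps ?Ss ?Ss' // ?(ltnW nj) //; ring.
apply: contraPT (sobolev_prod_gt0) => /[swap] /[apply].
suff -> : <[T, T]> = 0 by rewrite ltxx.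
apply: (@linear_form_eq0 R (fun r => <[T, r]>) S n.+1) => //.
- by move=> p q; exact: sobolev_prodDr.
- by move=> c p; exact: sobolev_prodZr.
- exact: hS.1.
move=> k kn; have [Skm Sks] := hS.1 k.
rewrite sobolev_prodC /T !sobolev_prodDr !sobolev_prodZr.
rewrite [<[S k, S n.+1]>]So; last by apply/eqP; rewrite ltn_eqF.
rewrite mulr0 add0r [<[_, P _]>]sobolev_prodC sobolev_charlier ?Sks //.
move: kn; rewrite ltnS leq_eqVlt => /predU1P[kn|kn]; last first.
  rewrite [<[_, _]>]So ?nth_default ?Sks ?mulr0 ?addr0 //.
  by apply/eqP; rewrite ltn_eqF.
(* Only [k = n] involves [a], which is exactly the Fourier coefficient of [P n.+1] along [S n]. *)
rewrite kn (monic_coef Sm' Ss') /a /sobolev_a /=.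
have := sobolev_prod_gt0 Sn0; move: <[_, _]> => h h0; field.
by rewrite !gt_eqF.
Qed.

End Connection.

(** * Asymptotic expansions and comparison of coefficients *)

(** The little-o condition as a null sequence. The offset [d] aligns expansions taken at
    neighbouring indices. *)
Lemma asymp_expansion_cvg (R : realType) m (f c : nat -> R) N d :
  asymp_expansion m f c ->
  (fun n => (n + d)%:R ^+ N *
     (f (n + d)%N - \sum_(m <= k < N.+1) c k / (n + d)%:R ^+ k))
    @ \oo --> 0.
Proof.
move=> /(_ N) fo.
pose g n := n%:R ^+ N * (f n - \sum_(m <= k < N.+1) c k / n%:R ^+ k).
rewrite (cvg_shiftn d g).
apply/cvgr0Pnorm_le => e e0.
move/eqoP : fo => /(_ e e0).
apply: filterS2 (nbhs_infty_gt 0) => n n0.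
rewrite /g normrM normfV ler_pdivlMr ?normr_gt0 ?expf_neq0 ?pnatr_eq0 -?lt0n //.
by rewrite mulrC.
Qed.

Lemma cvg_horner (R : realType) (u : nat -> R) (l : R) (p : {poly R}) :
  u @ \oo --> l -> (fun n => p.[u n]) @ \oo --> p.[l].
Proof.
move=> ul; elim/poly_ind: p => [|p c IH].
  by rewrite horner0; under eq_fun do rewrite horner0; exact: cvg_cst.
rewrite hornerMXaddC; under eq_fun do rewrite hornerMXaddC.
by apply: cvgD; [exact: cvgM|exact: cvg_cst].
Qed.

(** The constant term is the limit of [p] along [u], hence 0; cancelling one factor [u n] lowers [N]
    by one and repeats the argument. *)
Lemma poly_littleo_coef0 (R : realType) (u e : nat -> R) N (p : {poly R}) :
  u @ \oo --> 0 -> (forall n, u n != 0) -> e @ \oo --> 0 ->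
  (forall n, p.[u n] = u n ^+ N * e n) ->
  forall i, (i <= N)%N -> p`_i = 0.
Proof.
move=> ul u0 el.
have p0 q M : (forall n, q.[u n] = u n ^+ M * e n) -> q`_0 = 0.
  move=> qe; rewrite -horner_coef0 -(cvg_lim _ (cvg_horner (p := q) ul)) //.
  apply/cvg_lim => //; under eq_fun do rewrite qe -hornerXn.
  by rewrite -(mulr0 ('X^M).[0]); apply: cvgM => //; exact: cvg_horner.
elim: N p => [|N IH] p pe i iN.
  by move: iN; rewrite leqn0 => /eqP ->; exact: p0 pe.
have {}p0 := p0 _ _ pe.
case: i iN => // i iN; rewrite -addn1 -coef_drop_poly.
apply: IH => // n; apply: (mulIf (u0 n)).
have := pe n; rewrite -{1}(poly_take_drop 1 p) hornerD hornerM hornerX.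
suff -> : take_poly 1 p = 0 by rewrite horner0 add0r exprSr mulrAC.
by apply/polyP => -[|j]; rewrite coef_take_poly coef0.
Qed.

(* To be read with [u n = 1 / n] and [y = x + 1]: the assumed identity is then
   [(n - 1 - x) (s_n - p_n) = a_n s_(n-1)] multiplied by [u (1 - u)^2], where
   [d] is the difference of the coefficients of [s] and [p]. *)
Lemma recurrence_coefs (R : realType) (y z : R)
    (d sigma alpha u e1 e2 e3 : nat -> R) :
  u @ \oo --> 0 -> (forall n, u n != 0) ->
  e1 @ \oo --> 0 -> e2 @ \oo --> 0 -> e3 @ \oo --> 0 ->
  (forall n, (1 - u n) ^+ 2 * (1 - y * u n) *
      (d 0%N + d 1%N * u n + d 2%N * u n ^+ 2 + d 3%N * u n ^+ 3
       + d 4%N * u n ^+ 4 + u n ^+ 4 * e1 n) =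
    u n * (z * (u n + alpha 2%N * u n ^+ 2 + alpha 3%N * u n ^+ 3)
           + u n ^+ 3 * e2 n) *
    (sigma 0%N * (1 - u n) ^+ 2 + sigma 1%N * u n * (1 - u n)
     + sigma 2%N * u n ^+ 2 + u n ^+ 2 * e3 n)) ->
  [/\ d 0%N = 0, d 1%N = 0, d 2%N = z * sigma 0%N,
      d 3%N = z * (sigma 1%N + (y + alpha 2%N) * sigma 0%N)
    & d 4%N = z * (sigma 2%N + (y + 1 + alpha 2%N) * sigma 1%N
        + (y ^+ 2 + y * alpha 2%N + alpha 3%N) * sigma 0%N)].
Proof.
move=> ul u0 e1l e2l e3l rec.
pose A1 := - (2 + y); pose A2 := 1 + 2 * y; pose A3 := - y.
pose B1 := sigma 1%N - 2 * sigma 0%N.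
pose B2 := sigma 0%N - sigma 1%N + sigma 2%N.
(* Coefficients in [u] of left side minus right side without the error terms. Those of index 5 to 7
   only make the polynomial identity exact. *)
pose cs := [:: d 0%N;
  d 1%N + A1 * d 0%N;
  d 2%N + A1 * d 1%N + A2 * d 0%N - z * sigma 0%N;
  d 3%N + A1 * d 2%N + A2 * d 1%N + A3 * d 0%N
    - z * (B1 + alpha 2%N * sigma 0%N);
  d 4%N + A1 * d 3%N + A2 * d 2%N + A3 * d 1%N
    - z * (B2 + alpha 2%N * B1 + alpha 3%N * sigma 0%N);
  A1 * d 4%N + A2 * d 3%N + A3 * d 2%N - z * (alpha 2%N * B2 + alpha 3%N * B1);
  A2 * d 4%N + A3 * d 3%N - z * alpha 3%N * B2;
  A3 * d 4%N].
pose pB := Poly [:: sigma 0%N; B1; B2].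
pose pA := Poly [:: z; z * alpha 2%N; z * alpha 3%N].
pose pC := Poly [:: 1; A1; A2; A3].
(* All error terms, moved to the right and divided by [u n ^+ 4]. *)
pose e n := e2 n * (pB.[u n] + 'X^2.[u n] * e3 n)
  + pA.[u n] * e3 n - pC.[u n] * e1 n.
have el : e @ \oo --> 0.
  rewrite [X in _ --> X](_ : 0 =
    0 * (pB.[0] + 'X^2.[0] * 0) + pA.[0] * 0 - pC.[0] * 0); last by ring.
  apply: cvgB; last by apply: cvgM => //; exact: cvg_horner.
  apply: cvgD; last by apply: cvgM => //; exact: cvg_horner.
  apply: cvgM => //; apply: cvgD; first exact: cvg_horner.
  by apply: cvgM => //; exact: cvg_horner.
have coef0 i : (i <= 4)%N -> cs`_i = 0.
  rewrite -coef_Poly; apply: (poly_littleo_coef0 ul u0 el) => n.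
  apply/eqP; rewrite -subr_eq0; have /eqP := rec n.
  rewrite -subr_eq0 => /eqP r0; rewrite -[X in _ == X]r0; apply/eqP.
  rewrite /e hornerXn !horner_Poly /= /A1 /A2 /A3 /B1 /B2.
  ring.
have c0 : cs`_0 = 0 by exact: coef0.
have c1 : cs`_1 = 0 by exact: coef0.
have c2 : cs`_2 = 0 by exact: coef0.
have c3 : cs`_3 = 0 by exact: coef0.
have c4 : cs`_4 = 0 by exact: coef0.
rewrite /cs /= in c0 c1 c2 c3 c4.
have d1 : d 1%N = 0 by rewrite -c1 c0; ring.
have d2 : d 2%N = z * sigma 0%N by move: c2; rewrite c0 d1; lra.
have d3 : d 3%N = z * (sigma 1%N + (y + alpha 2%N) * sigma 0%N).
  by apply/eqP; rewrite -subr_eq0 -c3 c0 d1 d2 /B1 /A1; apply/eqP; ring.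
split=> //; apply/eqP; rewrite -subr_eq0 -c4 d1 d2 d3 /B1 /B2 /A1 /A2.
by apply/eqP; ring.
Qed.

(** Since [a n] is of order [1/n] and is divided by a factor of order [n], the fourth coefficient
    needs [a] only to order 3 and the preceding [s] only to order 2. *)
Lemma asymp_transfer (R : realType) (x z : R)
    (p s a omega alpha sigma : nat -> R) :
  asymp_expansion 0 p omega -> asymp_expansion 0 s sigma ->
  asymp_expansion 1 a (fun k => z * alpha k) ->
  omega 0%N = 1 -> alpha 1%N = 1 ->
  (forall n, (n%:R - x) * (s n.+1 - p n.+1) = a n.+1 * s n) ->
  [/\ sigma 0%N = 1,
      sigma 1%N = omega 1%N,
      sigma 2%N = omega 2%N + z,
      sigma 3%N = omega 3%N + (x + 1 + omega 1%N + alpha 2%N) * z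
    & sigma 4%N = omega 4%N
        + ((x + 1) ^+ 2 + (omega 1%N + alpha 2%N) * (x + 1)
           + z + omega 1%N * (1 + alpha 2%N)
           + omega 2%N + alpha 3%N) * z].
Proof.
move=> /(@asymp_expansion_cvg _ _ _ _ 4 2) pl sl.
move: (@asymp_expansion_cvg _ _ _ _ 4 2 sl) => s4l.
move: (@asymp_expansion_cvg _ _ _ _ 2 1 sl) => s2l.
move=> /(@asymp_expansion_cvg _ _ _ _ 3 2) al om0 al1 rec.
(* Indices are shifted so that both [n + 1] and [n + 2] are nonzero. *)
pose u (n : nat) : R := (n + 2)%:R^-1.
have ul : u @ \oo --> 0.
  have := @cvg_harmonic R; rewrite -(@cvg_shiftn 1 R^o (harmonic : nat -> R)).
  by rewrite /harmonic /u; under [in X in _ -> X]eq_fun do rewrite addn2 -addn1.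
have u0 n : u n != 0 by rewrite invr_eq0 pnatr_eq0 addn2.
have spl := cvgB (FF := eventually_filter) s4l pl; rewrite subr0 in spl.
have := @recurrence_coefs R (x + 1) z (fun k => sigma k - omega k) sigma alpha
  u _ _ _ ul u0 spl al s2l.
case=> [n | d0 d1 d2 d3 d4].
  rewrite !fctE /=.
  have := rec (n + 1)%N; rewrite -addnS /u.
  have -> : (n + 1)%:R = (n + 2)%:R - 1 :> R by rewrite !natrD; ring.
  have : (n + 2)%:R != 0 :> R by rewrite pnatr_eq0 addn2.
  have : (n + 2)%:R - 1 != 0 :> R.
    by rewrite -[1]/(1%:R) -natrB ?addn2 // subn1 pnatr_eq0.
  rewrite /index_iota /= !big_cons !big_nil al1.
  move: (n + 2)%:R (s (n + 2)%N) (s (n + 1)%N) (p _) (a _).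
  move=> m sm sn pm am m1 m0.
  move=> /eqP; rewrite -subr_eq0 => /eqP r0; apply/eqP.
  rewrite -subr_eq0; apply/eqP.
  (* With [u = 1/m] one has [1/(m - 1) = u/(1 - u)], so [(1 - u)^2] clears the denominators of the
     expansion of [s] at [m - 1]. *)
  move/(congr1 ( *%R (m^-1 * (1 - m^-1) ^+ 2))): r0.
  by rewrite mulr0 => r0; rewrite -[RHS]r0; field; rewrite m0.
have s0 : sigma 0%N = 1 by rewrite -om0 -[LHS](subrK (omega 0%N)) d0 add0r.
have s1 : sigma 1%N = omega 1%N by rewrite -[LHS](subrK (omega 1%N)) d1 add0r.
have s2 : sigma 2%N = omega 2%N + z.
  by rewrite -[LHS](subrK (omega 2%N)) d2 s0; ring.
split=> //; first by rewrite -[LHS](subrK (omega 3%N)) d3 s0 s1; ring.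
by rewrite -[LHS](subrK (omega 4%N)) d4 s0 s1 s2; ring.
Qed.

(** * Falling factorials and the conclusion *)

Lemma falling_polyS_horner (R : realType) n (x : R) :
  (falling_poly R n.+1).[x] = (falling_poly R n).[x] * (x - n%:R).
Proof. by rewrite /falling_poly big_ord_recr hornerM hornerXsubC. Qed.

Lemma falling_poly_neq0 (R : realType) n (x : R) :
  (forall k : nat, x <> k%:R) -> (falling_poly R n).[x] != 0.
Proof.
move=> hx; elim: n => [|n IH].
  by rewrite /falling_poly big_ord0 hornerC oner_eq0.
by rewrite falling_polyS_horner mulf_neq0 // subr_eq0; apply/eqP.
Qed.

Theorem theorem15 (R : realType) (b z lambda x : R)
  (P S : nat -> {poly R}) (omega alpha sigma : nat -> R)
  (hb : -1 < b) (hz : 0 < z) (hlambda : 0 <= lambda)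
  (hx : forall k : nat, x <> k%:R)
  (hP : monic_orthogonal (charlier_prod b z) P)
  (hS : monic_orthogonal (sobolev_prod b z lambda) S)
  (homega : asymp_expansion 0
     (fun n => (P n).[x] / (falling_poly R n).[x]) omega)
  (homega0 : omega 0%N = 1)
  (homega1 : omega 1%N = z)
  (homega2 : omega 2%N = (x + 1 - b) * z + z ^+ 2 / 2)
  (homega3 : omega 3%N =
     ((x + 1) * (x + 1 - b) + b ^+ 2) * z
     + (2 * (x + 1 - b) + 1) * (z ^+ 2 / 2) + z ^+ 3 / 6)
  (halpha : asymp_expansion 1
     (sobolev_a b z lambda P S) (fun k => z * alpha k))
  (halpha1 : alpha 1%N = 1)
  (halpha2 : alpha 2%N = 1 - 2 * b)
  (halpha3 : alpha 3%N = 1 + 3 * b * (b - 1) - z / lambda)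
  (hsigma : asymp_expansion 0
     (fun n => (S n).[x] / (falling_poly R n).[x]) sigma) :
  [/\ sigma 0%N = 1,
      sigma 1%N = z,
      sigma 2%N = omega 2%N + z,
      sigma 3%N = omega 3%N + (x + 1 + z + alpha 2%N) * z
    & sigma 4%N = omega 4%N
        + ((x + 1) ^+ 2 + (z + alpha 2%N) * (x + 1) + z * (2 + alpha 2%N)
           + omega 2%N + alpha 3%N) * z].
Proof.
have [n|s0 s1 s2 s3 s4] :=
  @asymp_transfer R x z _ _ _ _ _ _ homega hsigma halpha homega0 halpha1.
  (* The recurrence is the connection formula divided by the falling factorial of degree [n + 1],
     whose last factor [x - n] gives [n - x] after a change of sign. *)
  have f0 := falling_poly_neq0 n hx; have xn := hx n.
  rewrite (charlier_sobolev_connection hb hz hlambda hP hS n).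
  rewrite falling_polyS_horner hornerD hornerZ; field.
  by rewrite f0 subr_eq0; apply/eqP.
split=> //; [by rewrite s1|by rewrite s3 homega1|].
by rewrite s4 homega1; ring.
Qed.
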